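(* Let $\mathcal{C}$ be an equational class of algebras of the same type. (1) If $\mathcal{C}$ is congruence-modular, then any surjective morphism in $\mathcal{C}$ is admissible, but the converse is not true (an admissible morphism need not be surjective). (2) Any surjective morphism in $\mathcal{C}$ is Max-admissible, but the converse is not true (a Max-admissible morphism need not be surjective).
   Context: All algebras are non-empty. For an algebra $M$, $\mathrm{Con}(M)$ is the lattice of congruences of $M$, ordered by inclusion, with greatest element $\nabla_M=M^2$ and join $\vee$; $\mathrm{Max}(M)$ is the set of maximal elements of $\mathrm{Con}(M)\setminus\{\nabla_M\}$. An equational class is congruence-modular if $\mathrm{Con}(M)$ is a modular lattice for each of its members $M$. For a morphism $f:A\to B$, $\alpha\in\mathrm{Con}(A)$ and $\psi\in\mathrm{Con}(B)$, put $f(\alpha)=\{(f(a),f(b)) : (a,b)\in\alpha\}$, $f^*(\psi)=\{(a,b)\in A^2 : (f(a),f(b))\in\psi\}\in\mathrm{Con}(A)$ and $\mathrm{Ker}(f)=\{(a,b)\in A^2 : f(a)=f(b)\}$. If $\mathcal{C}$ is congruence-modular, the commutators $[\cdot,\cdot]_M$ of the members $M$ of $\mathcal{C}$ are the uniquely determined binary operations on $\mathrm{Con}(M)$ such that, for all $\alpha,\beta\in\mathrm{Con}(M)$, $[\alpha,\beta]_M$ is the least $\mu\in\mathrm{Con}(M)$ such that $\mu\subseteq\alpha\cap\beta$ and, for every algebra $N$ in $\mathcal{C}$ and every surjective morphism $h:M\to N$, $\mu\vee\mathrm{Ker}(h)=h^*([h(\alpha\vee\mathrm{Ker}(h)),h(\beta\vee\mathrm{Ker}(h))]_N)$.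 In that case, a congruence $\phi\neq\nabla_M$ of $M$ is prime if, for all $\alpha,\beta\in\mathrm{Con}(M)$, $[\alpha,\beta]_M\subseteq\phi$ implies $\alpha\subseteq\phi$ or $\beta\subseteq\phi$; $\mathrm{Spec}(M)$ is the set of prime congruences of $M$. A morphism $f:A\to B$ in a congruence-modular $\mathcal{C}$ is admissible if $f^*(\psi)\in\mathrm{Spec}(A)$ for all $\psi\in\mathrm{Spec}(B)$. A morphism $f:A\to B$ is Max-admissible if $f^*(\psi)\in\mathrm{Max}(A)$ for all $\psi\in\mathrm{Max}(B)$. *)

(* Defs.v *)
From mathcomp Require Import all_boot.
From mathcomp Require Import boolp classical_sets functions.

Set Implicit Arguments.
Unset Strict Implicit.
Unset Printing Implicit Defensive.

Local Open Scope classical_set_scope.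

Record signature := Signature {
  symbol : Type;
  arity : symbol -> nat }.

Record algebra (S : signature) := Algebra {
  carrier :> Type;
  interp : forall s : symbol S, ('I_(arity s) -> carrier) -> carrier;
  carrier_inhabited : inhabited carrier }.

Arguments interp {S} a s args.

Record morphism (S : signature) (A B : algebra S) := Morphism {
  morphism_fun :> A -> B;
  morphismP : forall (s : symbol S) (args : 'I_(arity s) -> A),
    morphism_fun (interp A s args) =
    interp B s (fun i => morphism_fun (args i)) }.

Definition surjective_morphism (S : signature) (A B : algebra S)
  (f : morphism A B) : Prop := set_surj [set: A] [set: B] f.

(* Equations are pairs of terms in countably many variables. *)
Inductive term (S : signature) : Type :=
| Var of nat
| App (s : symbol S) of ('I_(arity s) -> term S).

Fixpoint eval (S : signature) (A : algebra S) (v : nat -> A) (t : term S) : A :=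
  match t with
  | Var n => v n
  | App s args => interp A s (fun i => eval v (args i))
  end.

Definition satisfies (S : signature) (A : algebra S)
  (e : term S * term S) : Prop :=
  forall v : nat -> A, eval v e.1 = eval v e.2.

Definition equational_class (S : signature) (C : set (algebra S)) : Prop :=
  exists E : set (term S * term S),
    C = [set A | forall e, E e -> satisfies A e].

(* Con M, as a set of subsets of M^2; its greatest element is setT. *)
Definition Con (S : signature) (M : algebra S) : set (set (M * M)) :=
  [set theta |
    [/\ forall x, theta (x, x),
        forall x y, theta (x, y) -> theta (y, x),
        forall x y z, theta (x, y) -> theta (y, z) -> theta (x, z) &
        forall (s : symbol S) (a b : 'I_(arity s) -> M),
          (forall i, theta (a i, b i)) ->
          theta (interp M s a, interp M s b)]].

Definition Con_join (S : signature) (M : algebra S)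
  (alpha beta : set (M * M)) : set (M * M) :=
  smallest (@Con S M) (alpha `|` beta).

(* The meet of the lattice Con M is the intersection. *)
Definition Con_modular (S : signature) (M : algebra S) : Prop :=
  forall alpha beta gamma : set (M * M),
    Con alpha -> Con beta -> Con gamma -> alpha `<=` gamma ->
    Con_join alpha (beta `&` gamma) = Con_join alpha beta `&` gamma.

Definition congruence_modular (S : signature) (C : set (algebra S)) : Prop :=
  forall M, C M -> Con_modular M.

Definition Max (S : signature) (M : algebra S) : set (set (M * M)) :=
  [set phi | [/\ Con phi, phi <> setT &
    forall theta : set (M * M),
      Con theta -> theta <> setT -> phi `<=` theta -> theta = phi]].

Section Morphisms.
Variables (S : signature) (A B : algebra S) (f : morphism A B).

Definition Con_image (alpha : set (A * A)) : set (B * B) :=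
  [set (f p.1, f p.2) | p in alpha].

Definition Con_preimage (psi : set (B * B)) : set (A * A) :=
  [set p | psi (f p.1, f p.2)].

Definition Ker : set (A * A) := [set p | f p.1 = f p.2].

Definition Max_admissible : Prop :=
  forall psi, Max psi -> Max (Con_preimage psi).

End Morphisms.

(* A binary operation on the subsets of M^2 for every algebra M; only its values
   on congruences of members of the class under consideration matter. *)
Definition operations (S : signature) : Type :=
  forall M : algebra S, set (M * M) -> set (M * M) -> set (M * M).

Definition commutator_condition (S : signature) (C : set (algebra S))
  (comm : operations S) (M : algebra S) (alpha beta mu : set (M * M)) : Prop :=
  [/\ Con mu, mu `<=` alpha `&` beta &
    forall (N : algebra S) (h : morphism M N), C N -> surjective_morphism h ->
      Con_join mu (Ker h) =
      Con_preimage h (comm N (Con_image h (Con_join alpha (Ker h)))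
                             (Con_image h (Con_join beta (Ker h))))].

Definition commutators (S : signature) (C : set (algebra S))
  (comm : operations S) : Prop :=
  forall M, C M -> forall alpha beta : set (M * M), Con alpha -> Con beta ->
    commutator_condition C comm alpha beta (comm M alpha beta) /\
    forall mu : set (M * M),
      commutator_condition C comm alpha beta mu -> comm M alpha beta `<=` mu.

(* The condition [commutators] alone does not determine the operations: the
   constant operations with value the equality relation always fulfil it. The
   commutators of modular commutator theory are the greatest operations
   fulfilling it (Freese and McKenzie), and these are unique on congruences of
   members of C. *)
Definition greatest_commutators (S : signature) (C : set (algebra S))
  (comm : operations S) : Prop :=
  commutators C comm /\
  forall comm' : operations S, commutators C comm' ->
    forall M, C M -> forall alpha beta : set (M * M), Con alpha -> Con beta ->
      comm' M alpha beta `<=` comm M alpha beta.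

Definition Spec (S : signature) (comm : operations S) (M : algebra S) :
    set (set (M * M)) :=
  [set phi | [/\ Con phi, phi <> setT &
    forall alpha beta : set (M * M), Con alpha -> Con beta ->
      comm M alpha beta `<=` phi -> alpha `<=` phi \/ beta `<=` phi]].

Arguments Spec {S} comm M.

Definition admissible (S : signature) (comm : operations S) (A B : algebra S)
  (f : morphism A B) : Prop :=
  forall psi, Spec comm B psi -> Spec comm A (Con_preimage f psi).

(* Main.v *)
(** Admissibility along a surjection: the congruences of [B] correspond to those
    of [A] above [Ker f], and taking [h := f] in the commutator condition
    transports primality from [psi] to its preimage.

    For the failure of the converse take Boolean groups.  If
    [theta := {((x, y), (z, w)) | x + y = z + w, (y, w) in alpha}] and
    [eta := {((x, y), (z, w)) | x = z, (y, w) in beta}] are the congruences of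
    [M * M], they meet in equality and the second projection maps them onto
    [alpha] and [beta], so the commutator condition for that projection forces
    [[alpha, beta]] to be equality.  There are then no prime congruences and
    every morphism is admissible, for instance the zero endomorphism of [Z/2].

    For the Max-admissible case take the inclusion of the multiplicative monoid
    [{0, 1}] in that of the natural numbers: a congruence of the latter
    identifying [0 = 0 * n] and [1] also identifies [0] and [n = 1 * n]. *)
Require Import Defs.
From mathcomp Require Import all_boot.
From mathcomp Require Import boolp classical_sets functions.

Set Implicit Arguments.
Unset Strict Implicit.
Unset Printing Implicit Defensive.

Local Open Scope classical_set_scope.

(** * Congruences: preimages, joins and images *)

Definition eq_con (S : signature) (M : algebra S) : set (M * M) :=
  [set p | p.1 = p.2].
Arguments eq_con {S} M _.

Section Congruences.
Context {S : signature}.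
Implicit Types A B M : algebra S.

Lemma Con_eq M : Con (eq_con M).
Proof.
rewrite /eq_con; split=> //= [x y z -> //|s a b ab].
by congr interp; apply: funext.
Qed.

Lemma eq_con_sub M (theta : set (M * M)) : Con theta -> eq_con M `<=` theta.
Proof. by move=> [r _ _ _] [x y]; rewrite /eq_con /= => ->. Qed.

Lemma Con_preimage_Con A B (f : morphism A B) psi :
  Con psi -> Con (Con_preimage f psi).
Proof.
move=> [r s t c]; split=> /= [x|x y|x y z|u a b ab].
- exact: r.
- exact: s.
- exact: t.
- by rewrite /Con_preimage /= !morphismP; apply: c.
Qed.

Lemma Ker_sub_preimage A B (f : morphism A B) psi :
  Con psi -> Ker f `<=` Con_preimage f psi.
Proof. by move=> /eq_con_sub psi_refl p fp; apply: psi_refl. Qed.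

Lemma Con_join_Con M (alpha beta : set (M * M)) : Con (Con_join alpha beta).
Proof.
split=> [x g [[r _ _ _] _]|x y xy g gP|x y z xy yz g gP|u a b ab g gP].
- exact: r.
- by case: (gP) => -[_ s _ _] _; apply: s; apply: xy.
- by case: (gP) => -[_ _ t _] _; apply: (t _ y); [apply: xy|apply: yz].
- by case: (gP) => -[_ _ _ c] _; apply: c => i; apply: ab.
Qed.

Lemma Con_join_l M (alpha beta : set (M * M)) : alpha `<=` Con_join alpha beta.
Proof. by move=> p ap g [_]; apply; left. Qed.

Lemma Con_join_r M (alpha beta : set (M * M)) : beta `<=` Con_join alpha beta.
Proof. by move=> p bp g [_]; apply; right. Qed.

Lemma Con_join_sub M (alpha beta gamma : set (M * M)) :
  Con gamma -> alpha `<=` gamma -> beta `<=` gamma ->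
  Con_join alpha beta `<=` gamma.
Proof. by move=> cg ag bg p; apply; split=> // q [/ag|/bg]. Qed.

(** A congruence above the kernel is saturated: by transitivity through [Ker f], representatives of
    a pair of the image can be exchanged freely. *)
Lemma Con_imageE A B (f : morphism A B) gamma x y :
  Con gamma -> Ker f `<=` gamma ->
  Con_image f gamma (f x, f y) <-> gamma (x, y).
Proof.
move=> [_ s t _] Kg; split=> [[[a b] /= ab [fa fb]]|xy]; last by exists (x, y).
apply: (t _ b); last exact: Kg.
by apply: (t _ a) ab; apply/s/Kg.
Qed.

(** A set-theoretic section [g] of [f] turns the image into the inverse image of [gamma] under [g].
    As [g] need not be a morphism, compatibility goes through [gE], which evaluates operations of
    [B] on lifted arguments. *)
Lemma Con_image_Con A B (f : morphism A B) gamma :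
  surjective_morphism f -> Con gamma -> Ker f `<=` gamma ->
  Con (Con_image f gamma).
Proof.
move=> surj cg Kg.
have {surj} /choice[g gK] : forall b, exists a, f a = b.
  by move=> b; have [a _ <-] := surj b I; exists a.
have E x y : Con_image f gamma (x, y) <-> gamma (g x, g y).
  by rewrite -{1}(gK x) -{1}(gK y); apply: Con_imageE.
case: (cg) => r s t c; split=> [x|x y|x y z|u a b ab].
- exact/E.
- by move=> /E xy; apply/E/s.
- by move=> /E xy /E yz; apply/E/(t _ (g y)).
- have gE (d : 'I_(arity u) -> B) : interp B u d = f (interp A u (g \o d)).
    by rewrite morphismP; congr interp; apply: funext => i /=; rewrite gK.
  by rewrite !gE; apply/Con_imageE => //; apply: c => i /=; apply/E.
Qed.

Lemma Con_preimage_proper A B (f : morphism A B) psi :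
  surjective_morphism f -> psi <> setT -> Con_preimage f psi <> setT.
Proof.
move=> surj psiT preT; apply: psiT; apply/seteqP; split=> // -[x y] _.
have [[a _ <-] [b _ <-]] := (surj x I, surj y I).
by rewrite -[psi _]/(Con_preimage f psi (a, b)) preT.
Qed.

(** * Surjective morphisms and the commutator condition *)

Lemma surjective_Max_admissible A B (f : morphism A B) :
  surjective_morphism f -> Max_admissible f.
Proof.
move=> surj psi [cpsi psiT psiM].
split=> [||theta ctheta thetaT sub]; first exact: Con_preimage_Con.
  exact: Con_preimage_proper.
(* Being above [Ker f], [theta] has a proper congruence as image; this image contains [psi], so
   maximality identifies the two, and saturation recovers [theta] as the preimage. *)
have Kt := subset_trans (Ker_sub_preimage cpsi) sub.
have <- : Con_image f theta = psi.
  apply: psiM; first exact: Con_image_Con.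
    move=> imT; apply: thetaT; apply/seteqP; split=> // -[x y] _.
    by apply/(Con_imageE _ _ ctheta Kt); rewrite imT.
  move=> [x y]; have [[a _ <-] [b _ <-]] := (surj x I, surj y I) => ab.
  by exists (a, b) => //; apply: sub.
by apply/seteqP; split=> -[x y] /(Con_imageE _ _ ctheta Kt).
Qed.

Lemma surjective_admissible (C : set (algebra S)) (comm : operations S) A B
    (f : morphism A B) :
  commutators C comm -> C A -> C B -> surjective_morphism f ->
  admissible comm f.
Proof.
move=> commC CA CB surj psi [cpsi psiT psiP].
split=> [||alpha beta ca cb sub]; first exact: Con_preimage_Con.
  exact: Con_preimage_proper.
have [[_ _ /(_ B f CB surj) E] _] := commC A CA _ _ ca cb.
have imC gamma : Con (Con_image f (Con_join gamma (Ker f))).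
  by apply: Con_image_Con => //; [exact: Con_join_Con|exact: Con_join_r].
have imS gamma : Con_image f (Con_join gamma (Ker f)) `<=` psi ->
    gamma `<=` Con_preimage f psi.
  by move=> im p gp; apply: im; exists p => //; apply: Con_join_l.
have [|im|im] := psiP _ _ (imC alpha) (imC beta); last 2 first.
- by left; apply: imS.
- by right; apply: imS.
(* The premise of primality is left: pulled back along [f], the commutator of the images is the join
   of [comm A alpha beta] and [Ker f], both below the preimage of [psi]. *)
move=> [x y]; have [[a _ <-] [b _ <-]] := (surj x I, surj y I) => xy.
have : Con_preimage f psi (a, b); last by [].
apply: (Con_join_sub (Con_preimage_Con f cpsi) sub (Ker_sub_preimage cpsi)).
by rewrite E.
Qed.

(** Serves to evaluate the arguments of the commutator on the target without describing the join
    with the kernel explicitly. *)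
Lemma Con_image_join A B (f : morphism A B) gamma alpha :
  Con alpha -> gamma `<=` Con_preimage f alpha ->
  alpha `<=` Con_image f gamma ->
  Con_image f (Con_join gamma (Ker f)) = alpha.
Proof.
move=> ca sub sup; apply/seteqP; split=> [_ [p jp <-]|p /sup[q gq <-]].
  apply: (Con_join_sub (Con_preimage_Con f ca) sub _ jp).
  exact: Ker_sub_preimage.
by exists q => //; apply: Con_join_l.
Qed.

(** The preimage of equality under [h] is [Ker h], which is also the join of equality with [Ker h].
    Minimality holds because equality is the least congruence. *)
Lemma commutators_eq_con (C : set (algebra S)) :
  commutators C (fun M _ _ => eq_con M).
Proof.
move=> M CM alpha beta ca cb.
split; last by move=> mu [cmu _ _]; apply: eq_con_sub.
split=> [||N h CN surj]; first exact: Con_eq.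
  by move=> p ep; split; apply: eq_con_sub ep.
have cK : Con (Ker h) by exact: (Con_preimage_Con h (Con_eq N)).
apply/seteqP; split; last exact: Con_join_r.
by apply: Con_join_sub => //; apply: eq_con_sub.
Qed.

(** * Binary products *)

Definition prod_interp A B (s : symbol S) (args : 'I_(arity s) -> A * B) :=
  (interp A s (fun i => (args i).1), interp B s (fun i => (args i).2)).

Lemma prod_inhabited A B : inhabited (A * B).
Proof. by have [[a] [b]] := (carrier_inhabited A, carrier_inhabited B). Qed.

Definition prod_algebra A B : algebra S :=
  Algebra (@prod_interp A B) (prod_inhabited A B).

Definition snd_morphism A B : morphism (prod_algebra A B) B :=
  @Morphism S (prod_algebra A B) B snd (fun _ _ => erefl).

Lemma snd_surjective A B : surjective_morphism (snd_morphism A B).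
Proof. by have [a] := carrier_inhabited A; move=> b _; exists (a, b). Qed.

Lemma eval_prod A B (v : nat -> prod_algebra A B) t :
  eval v t = (eval (fst \o v) t, eval (snd \o v) t).
Proof.
elim: t => [n|s args IH] /=; first by case: (v n).
by congr pair; congr interp; apply: funext => i; rewrite IH.
Qed.

(** Terms evaluate coordinatewise. This keeps squares inside the class, so that the commutator
    condition can be tested on their projections. *)
Lemma equational_prod (C : set (algebra S)) A B :
  equational_class C -> C A -> C B -> C (prod_algebra A B).
Proof.
by move=> [E ->] CA CB e Ee v; rewrite !eval_prod (CA e Ee) (CB e Ee).
Qed.

End Congruences.

(** * Algebras with a single binary operation *)

Section BinaryAlgebras.

Definition binary_signature := Signature (fun _ : unit => 2).

Definition args2 T (x y : T) (i : 'I_2) : T := if i == ord0 then x else y.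

Lemma args2_eta T (a : 'I_2 -> T) : a = args2 (a ord0) (a ord_max).
Proof.
by apply: funext => i; rewrite /args2; case: eqP => [->//|/eqP i0];
  congr a; apply: val_inj; case: i i0 => -[|[|//]].
Qed.

Lemma args2_comp T U (f : T -> U) x y :
  (fun i => f (args2 x y i)) = args2 (f x) (f y).
Proof. by apply: funext => i; rewrite /args2; case: ifP. Qed.

Definition op (M : algebra binary_signature) (x y : M) : M :=
  interp M tt (args2 x y).

Definition binary_algebra T (o : T -> T -> T) (x : T) :=
  @Algebra binary_signature T (fun _ a => o (a ord0) (a ord_max)) (inhabits x).

Lemma Con_binary (M : algebra binary_signature) (theta : set (M * M)) :
  (forall x, theta (x, x)) ->
  (forall x y, theta (x, y) -> theta (y, x)) ->
  (forall x y z, theta (x, y) -> theta (y, z) -> theta (x, z)) ->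
  (forall x y z t, theta (x, y) -> theta (z, t) -> theta (op x z, op y t)) ->
  Con theta.
Proof.
move=> r s t c; split=> // -[] a b ab.
by rewrite (args2_eta a) (args2_eta b); apply: c; apply: ab.
Qed.

Lemma Con_op (M : algebra binary_signature) (theta : set (M * M)) x y z t :
  Con theta -> theta (x, y) -> theta (z, t) -> theta (op x z, op y t).
Proof.
by move=> [_ _ _ c] xy zt; apply: c => i; rewrite /args2; case: ifP.
Qed.

End BinaryAlgebras.

(** * Boolean groups: modularity and triviality of commutators *)

Section BooleanGroups.

Let App2 (t u : term binary_signature) : term binary_signature :=
  @App binary_signature tt (args2 t u).
Let X : term binary_signature := Var _ 0.
Let Y : term binary_signature := Var _ 1.
Let Z : term binary_signature := Var _ 2.

(** By associativity the last equation makes every [x + x] neutral, hence every element its own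
    inverse: the identity element is expressed without a constant. *)
Definition boolean_group_equations :
    set (term binary_signature * term binary_signature) :=
  [set (App2 X (App2 Y Z), App2 (App2 X Y) Z)] `|`
  [set (App2 X Y, App2 Y X)] `|` [set (App2 X (App2 X Y), Y)].

Definition boolean_groups : set (algebra binary_signature) :=
  [set M | forall e, boolean_group_equations e -> satisfies M e].

Lemma equational_boolean_groups : equational_class boolean_groups.
Proof. by exists boolean_group_equations. Qed.

Lemma eval_App2 (M : algebra binary_signature) (v : nat -> M) t u :
  eval v (App2 t u) = op (eval v t) (eval v u).
Proof. by rewrite /= args2_comp. Qed.

Lemma boolean_groupP (M : algebra binary_signature) :
  boolean_groups M <->
  [/\ associative (@op M), commutative (@op M) &
      forall x y : M, op x (op x y) = y].
Proof.
split=> [CM|[A C I] e [[|]|] -> v]; last first.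
- by rewrite /= -![interp _ _ _]/(eval v (App2 _ _)) !eval_App2 I.
- by rewrite /= -![interp _ _ _]/(eval v (App2 _ _)) !eval_App2 C.
- by rewrite /= -![interp _ _ _]/(eval v (App2 _ _)) !eval_App2 A.
(* The default value of [nth] is what assigns [z] to the third variable. *)
pose v (x y z : M) n := nth z [:: x; y] n.
split=> [x y z|x y|x y].
- have := CM _ (or_introl (or_introl erefl)) (v x y z).
  by rewrite [fst _]/= [snd _]/= !eval_App2.
- have := CM _ (or_introl (or_intror erefl)) (v x y x).
  by rewrite [fst _]/= [snd _]/= !eval_App2.
- have := CM _ (or_intror erefl) (v x y x).
  by rewrite [fst _]/= [snd _]/= !eval_App2.
Qed.

(** The witness is the Mal'cev term [x + y + z]: replacing [z] by [y] modulo [alpha] gives [x], and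
    replacing [x] by [y] modulo [beta] gives [z]. *)
Lemma boolean_group_permute (M : algebra binary_signature)
    (alpha beta : set (M * M)) x y z :
  boolean_groups M -> Con alpha -> Con beta ->
  beta (x, y) -> alpha (y, z) ->
  exists2 u, alpha (x, u) & beta (u, z).
Proof.
move=> /boolean_groupP[A C I] ca cb xy yz; exists (op x (op y z)).
  have [r _ _ _] := ca.
  have /(Con_op ca (r x)) : alpha (op y y, op y z) by apply: Con_op.
  by rewrite (C x (op y y)) -A I.
have [r _ _ _] := cb.
have /(Con_op cb xy) : beta (op y z, op y z) by [].
by rewrite I.
Qed.

(** Permuting congruences are modular: the join is the relational product, and if [x alpha u beta y]
    with [x gamma y], then [alpha] lying below [gamma] yields [u gamma y]. *)
Lemma boolean_group_modular : congruence_modular boolean_groups.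
Proof.
move=> M CM alpha beta gamma ca cb cg ag; apply/seteqP; split.
  apply: Con_join_sub.
  - have [r s t c] := Con_join_Con alpha beta; have [r' s' t' c'] := cg.
    split=> [x|x y [? ?]|x y z [? ?] [? ?]|u a b ab].
    + by split.
    + by split; [apply: s|apply: s'].
    + by split; [apply: t; eassumption|apply: t'; eassumption].
    + by split; [apply: c => i|apply: c' => i]; case: (ab i).
  - by move=> p ap; split; [apply: Con_join_l|apply: ag].
  - by move=> p [bp gp]; split=> //; apply: Con_join_r.
pose comp : set (M * M) :=
  [set p | exists2 u, alpha (p.1, u) & beta (u, p.2)].
have [ra sa ta cpa] := ca; have [rb sb tb cpb] := cb.
(* Permutability provides symmetry and transitivity of the product. *)
have compC : Con comp.
  apply: Con_binary => [x|x y [u xu uy]|x y z [u xu uy] [w yw wz]|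
                        x y z t [u xu uy] [w zw wt]].
  - by exists x.
  - by apply: (boolean_group_permute CM ca cb (sb _ _ uy) (sa _ _ xu)).
  - have [p up pw] := boolean_group_permute CM ca cb uy yw.
    by exists p => /=; [apply: ta up|apply: tb wz].
  - by exists (op u w); apply: Con_op.
move=> [x y] [jxy gxy].
have [||u /= xu uy] := Con_join_sub compC _ _ jxy.
- by move=> [a b] ab; exists b.
- by move=> [a b] ab; exists a.
have [rj sj tj _] := Con_join_Con alpha (beta `&` gamma).
have [_ sg tg _] := cg.
apply: (tj _ u); first exact: Con_join_l.
apply: Con_join_r; split=> //; apply: tg gxy.
exact/sg/ag.
Qed.

Lemma boolean_group_commutator_sub (comm : operations binary_signature)
    (M : algebra binary_signature) (alpha beta : set (M * M)) :
  commutators boolean_groups comm -> boolean_groups M ->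
  Con alpha -> Con beta -> comm M alpha beta `<=` eq_con M.
Proof.
move=> commC CM ca cb.
have [A C I] := (boolean_groupP M).1 CM.
have CMM := equational_prod equational_boolean_groups CM CM.
pose MM := prod_algebra M M; pose h : morphism MM M := snd_morphism M M.
have opE (p q : MM) : op p q = (op p.1 q.1, op p.2 q.2).
  by rewrite /op -!args2_comp.
pose theta : set (MM * MM) :=
  [set p | op p.1.1 p.1.2 = op p.2.1 p.2.2 /\ alpha (p.1.2, p.2.2)].
pose eta : set (MM * MM) := [set p | p.1.1 = p.2.1 /\ beta (p.1.2, p.2.2)].
(* The medial law: addition is a morphism from [MM] to [M], whence the compatibility of [theta]. *)
have AC (x y z t : M) : op (op x y) (op z t) = op (op x z) (op y t).
  by rewrite -!A; congr op; rewrite A (C y) -A.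
have ctheta : Con theta.
  have [r s t c] := ca.
  apply: Con_binary.
  - by [].
  - by move=> x y [/= xy axy]; split; last exact: s.
  - move=> x y z [/= xy axy] [/= yz ayz].
    by split; [rewrite /= xy|apply: t axy ayz].
  - move=> x y z w [xy axy] [zw azw]; rewrite !opE.
    by split; rewrite /= in xy zw *; [rewrite AC xy zw AC|apply: Con_op].
have ceta : Con eta.
  have [r s t c] := cb.
  apply: Con_binary.
  - by [].
  - by move=> x y [/= xy bxy]; split; last exact: s.
  - move=> x y z [/= xy bxy] [/= yz byz].
    by split; [rewrite /= xy|apply: t bxy byz].
  - move=> x y z w [xy bxy] [zw bzw]; rewrite !opE.
    by split; rewrite /= in xy zw *; [rewrite xy zw|apply: Con_op].
have [[_ sub /(_ M h CM (@snd_surjective _ M M)) E] _] :=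
  commC MM CMM theta eta ctheta ceta.
(* Equal first coordinates and equal sums force equal second coordinates, by cancellation. *)
have {}sub : comm MM theta eta `<=` Ker h.
  move=> [[x y] [z w]] /sub[[/= xyzw _] [/= xz _]].
  by rewrite /Ker /= -(I x y) xyzw xz I.
have thetaI : Con_image h (Con_join theta (Ker h)) = alpha.
  apply: Con_image_join => // [p []//|[y w] yw].
  (* A diagonal lift works since [y + y] and [w + w] are both the neutral element. *)
  exists ((y, y), (w, w)) => //; split=> //=.
  by rewrite -[LHS](I w) (C w (op y y)) -A I.
have etaI : Con_image h (Con_join eta (Ker h)) = beta.
  apply: Con_image_join => // [p []//|[y w] yw].
  by exists ((y, y), (y, w)).
move=> [x y] xy.
(* Any lift of [(x, y)] along the second projection would do. The join collapses to [Ker h], so the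
   second coordinates agree. *)
have : Con_join (comm MM theta eta) (Ker h) ((x, x), (x, y)).
  by rewrite E thetaI etaI.
apply: (Con_join_sub _ sub) => //.
exact: (Con_preimage_Con h (Con_eq M)).
Qed.

Lemma boolean_group_admissible (comm : operations binary_signature)
    (A B : algebra binary_signature) (f : morphism A B) :
  commutators boolean_groups comm -> boolean_groups B -> admissible comm f.
Proof.
move=> commC CB psi [cpsi psiT psiP]; case: psiT; apply/seteqP; split=> //.
have cT : Con [set: B * B] by [].
(* The commutator of the total congruence with itself is below every congruence, so a prime [psi]
   would be total. *)
case: (psiP _ _ cT cT) => //.
apply: subset_trans (eq_con_sub cpsi).
exact: boolean_group_commutator_sub.
Qed.

(** Ensures that the quantification over [comm] in the counterexample is not vacuous and covers the
    genuine commutators. *)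
Lemma boolean_groups_greatest_commutators :
  greatest_commutators boolean_groups (fun M _ _ => eq_con M).
Proof.
split; first exact: commutators_eq_con.
move=> comm commC M CM alpha beta ca cb.
exact: boolean_group_commutator_sub.
Qed.

Definition xor_algebra := binary_algebra addb false.

Lemma boolean_group_xor : boolean_groups xor_algebra.
Proof.
by apply/boolean_groupP; split; do 3?[case=> //|move=> ?].
Qed.

Definition zero_endomorphism : morphism xor_algebra xor_algebra :=
  @Morphism _ xor_algebra xor_algebra (fun _ => false) (fun _ _ => erefl).

Lemma zero_endomorphism_not_surjective :
  ~ surjective_morphism zero_endomorphism.
Proof. by move=> /(_ true I)[]. Qed.

End BooleanGroups.

(** * Multiplicative monoids: a Max-admissible morphism that is not surjective *)

Section MultiplicativeMonoids.

Definition and_algebra := binary_algebra andb true.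
Definition mul_algebra := binary_algebra muln 1.

Lemma nat_of_bool_morphism_axiom (s : symbol binary_signature)
    (args : 'I_(arity s) -> and_algebra) :
  nat_of_bool (interp and_algebra s args) =
  interp mul_algebra s (fun i => nat_of_bool (args i)).
Proof. by rewrite /= mulnb. Qed.

Definition nat_of_bool_morphism : morphism and_algebra mul_algebra :=
  @Morphism _ and_algebra mul_algebra nat_of_bool nat_of_bool_morphism_axiom.

(** A set with two elements carries only two equivalence relations. *)
Lemma and_algebra_simple (theta : set (and_algebra * and_algebra)) :
  Con theta -> theta <> setT -> theta = eq_con and_algebra.
Proof.
move=> ct tT; case: (ct) => r s _ _.
apply/seteqP; split; last exact: eq_con_sub.
have nt : ~ theta (true, false).
  move=> tf; apply: tT; apply/seteqP; split=> // -[[] []] _ //.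
  exact: s.
by move=> [[] []] // /s.
Qed.

Lemma mul_algebra_collapse (psi : set (mul_algebra * mul_algebra)) :
  Con psi -> psi (0, 1) -> psi = setT.
Proof.
move=> cpsi p01; case: (cpsi) => r s t _.
have p0 n : psi (0, n).
  by have := Con_op cpsi p01 (r n); rewrite /op /= mul0n mul1n.
by apply/seteqP; split=> // -[m n] _; apply: (t _ 0) => //; apply: s.
Qed.

(** By [mul_algebra_collapse] the preimage is proper, and in the simple algebra [and_algebra] a
    proper congruence is equality, hence maximal. *)
Lemma nat_of_bool_Max_admissible : Max_admissible nat_of_bool_morphism.
Proof.
move=> psi [cpsi psiT _].
have cpre := Con_preimage_Con nat_of_bool_morphism cpsi.
have preT : Con_preimage nat_of_bool_morphism psi <> setT.
  move=> preT; apply/psiT/mul_algebra_collapse => //.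
  have : Con_preimage nat_of_bool_morphism psi (false, true) by rewrite preT.
  by [].
split=> // theta ct tT _.
by rewrite (and_algebra_simple ct tT) (and_algebra_simple cpre preT).
Qed.

Lemma nat_of_bool_not_surjective : ~ surjective_morphism nat_of_bool_morphism.
Proof. by move=> /(_ 2 I)[[]]. Qed.

End MultiplicativeMonoids.

Theorem proposition8p2 :
  (* congruence-modular: surjective implies admissible ... *)
  (forall (S : signature) (C : set (algebra S)) (comm : operations S),
     equational_class C -> congruence_modular C -> commutators C comm ->
     forall (A B : algebra S) (f : morphism A B), C A -> C B ->
       surjective_morphism f -> admissible comm f) /\
  (* ... but not conversely *)
  (exists (S : signature) (C : set (algebra S)) (A B : algebra S)
     (f : morphism A B),
     [/\ equational_class C, congruence_modular C, C A & C B] /\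
     [/\ exists comm : operations S, greatest_commutators C comm,
         forall comm : operations S, commutators C comm -> admissible comm f &
         ~ surjective_morphism f]) /\
  (* surjective implies Max-admissible ... *)
  (forall (S : signature) (C : set (algebra S)),
     equational_class C ->
     forall (A B : algebra S) (f : morphism A B), C A -> C B ->
       surjective_morphism f -> Max_admissible f) /\
  (* ... but not conversely *)
  (exists (S : signature) (C : set (algebra S)) (A B : algebra S)
     (f : morphism A B),
     [/\ equational_class C, C A & C B] /\
     Max_admissible f /\ ~ surjective_morphism f).
Proof.
split; [|split; [|split]].
- by move=> S C comm _ _ commC A B f; apply: surjective_admissible.
- exists binary_signature, boolean_groups, xor_algebra, xor_algebra.
  exists zero_endomorphism; split; split.
  + exact: equational_boolean_groups.
  + exact: boolean_group_modular.
  + exact: boolean_group_xor.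
  + exact: boolean_group_xor.
  + exists (fun M _ _ => eq_con M).
    exact: boolean_groups_greatest_commutators.
  + move=> comm commC; apply: boolean_group_admissible commC _.
    exact: boolean_group_xor.
  + exact: zero_endomorphism_not_surjective.
- by move=> S C _ A B f _ _; apply: surjective_Max_admissible.
(* The class of all algebras of the signature is defined by the empty set of equations. *)
- exists binary_signature, setT, and_algebra, mul_algebra, nat_of_bool_morphism.
  split.
    by split=> //; exists set0; apply/esym; rewrite -subTset => M _ e [].
  split; first exact: nat_of_bool_Max_admissible.
  exact: nat_of_bool_not_surjective.
Qed.
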